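(* Let $n\ge 2$, $d\ge 1$ and $t\ge 0$ be integers, and let $A$ be any deterministic algorithm that correctly solves the sum-exclude-self problem on all inputs $\mathit{In}\in\{0,\ldots,2^d-1\}^n$ in the model of computation described in the context, using at most $t$ bits of working memory. Then $A$ must read at least $nd-t$ bits from $\mathit{In}$ during the second pass (maximized over all inputs), i.e. at least $n-\lfloor t/d\rfloor$ elements of $\mathit{In}$ during the second pass.
   Context: The sum-exclude-self problem: given an array $\mathit{In}=(\mathit{In}[0],\ldots,\mathit{In}[n-1])\in\{0,\ldots,2^d-1\}^n$ of $d$-bit unsigned integers, compute $\mathit{Out}\in\mathbb{Z}^n$ with $\mathit{Out}[i]=\sum_{j\neq i}\mathit{In}[j]$ for all $0\le i<n$. Model of computation: the algorithm reads elements of the read-only input array $\mathit{In}$ (each read retrieves one $d$-bit element) and writes to the output array $\mathit{Out}$, which is write-only: it may write any output cell at any time and may overwrite earlier values, but can never read from $\mathit{Out}$. Between any two read or write operations the algorithm keeps at most $t$ bits of working memory. Arithmetic is over $\mathbb{Z}$ with no overflow. Correctness means that at the end of execution every cell $\mathit{Out}[i]$ holds the correct value. For each output cell, its final write is the last write to that cell during execution. The second pass is the time interval from the earliest final write to any output cell until the end of execution. The number of bits read during the second pass is $d$ times the number of input elements read in that interval; the bound refers to the maximum of this quantity over all inputs. *)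

(* Defs.v *)
From mathcomp Require Import all_boot all_order all_algebra.
Set Implicit Arguments.
Unset Strict Implicit.
Unset Printing Implicit Defensive.
Import GRing.Theory.
Local Open Scope ring_scope.

Definition input (n d : nat) := {ffun 'I_n -> 'I_(2 ^ d)}.

Definition sum_excl_self n d (In : input n d) (i : 'I_n) : int :=
  \sum_(j < n | j != i) (In j)%:Z.

(* The next memory contents are an [option]: [None] means that execution ends
   after the operation, so that ending does not cost a memory state.  There is
   no operation that reads the output array. *)
Inductive action (n d : nat) (M : Type) : Type :=
| Read of 'I_n & ('I_(2 ^ d) -> option M)
| Write of 'I_n & int & option M.
Arguments Read {n d M}.
Arguments Write {n d M}.

(* The working memory is all that survives from one operation to the next: in
   particular the program counter, if any, is part of it.  Computation between
   two operations is an arbitrary function of the memory contents (and of the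
   element just read). *)
Record algorithm (n d : nat) : Type := Algorithm {
  mem_bits : nat;
  init_mem : mem_bits.-tuple bool;
  step : mem_bits.-tuple bool -> action n d (mem_bits.-tuple bool)
}.
Arguments step {n d} A m : rename.

Inductive event (n : nat) : Type :=
| ReadEv of 'I_n
| WriteEv of 'I_n & int.
Arguments ReadEv {n}.
Arguments WriteEv {n}.

Definition is_read n (e : event n) : bool :=
  if e is ReadEv _ then true else false.

Definition writes_to n (i : 'I_n) (e : event n) : bool :=
  if e is WriteEv j _ then j == i else false.

(* [run_from A In m tr]: started with memory [m] ([None] if execution has
   ended), [A] terminates on [In] after performing exactly the operations
   [tr]. *)
Inductive run_from n d (A : algorithm n d) (In : input n d) :
    option ((mem_bits A).-tuple bool) -> seq (event n) -> Prop :=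
| run_halt : @run_from n d A In None [::]
| run_read m i next tr :
    step A m = Read i next ->
    @run_from n d A In (next (In i)) tr ->
    @run_from n d A In (Some m) (ReadEv i :: tr)
| run_write m i v next tr :
    step A m = Write i v next ->
    @run_from n d A In next tr ->
    @run_from n d A In (Some m) (WriteEv i v :: tr).
Arguments run_from {n d} A In m tr.

Definition run n d (A : algorithm n d) (In : input n d) (tr : seq (event n)) :
    Prop :=
  run_from A In (Some (init_mem A)) tr.

(* [None] is the contents of a cell that has never been written. *)
Definition out_array (n : nat) := {ffun 'I_n -> option int}.

Definition exec_event n (out : out_array n) (e : event n) : out_array n :=
  if e is WriteEv i v then [ffun j => if j == i then Some v else out j]
  else out.

Definition output n (tr : seq (event n)) : out_array n :=
  foldl (@exec_event n) [ffun=> None] tr.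

Definition solves_sum_exclude_self n d (A : algorithm n d) : Prop :=
  forall In : input n d, exists tr : seq (event n),
    run A In tr /\ forall i : 'I_n, output tr i = Some (sum_excl_self In i).

Definition is_final_write n (e : event n) (later : seq (event n)) : bool :=
  if e is WriteEv i _ then ~~ has (writes_to i) later else false.

Fixpoint second_pass n (tr : seq (event n)) : seq (event n) :=
  if tr is e :: later then
    if is_final_write e later then tr else second_pass later
  else [::].

Definition second_pass_reads n (tr : seq (event n)) : nat :=
  count (@is_read n) (second_pass tr).

Definition max_second_pass_reads n d (A : algorithm n d) (r : nat) : Prop :=
  (exists (In : input n d) (tr : seq (event n)),
     run A In tr /\ second_pass_reads tr = r) /\
  (forall (In : input n d) (tr : seq (event n)),
     run A In tr -> (second_pass_reads tr <= r)%N).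

(* Main.v *)
Require Import Defs.
From mathcomp Require Import all_boot all_order all_algebra.
From mathcomp Require Import zify.

(** The second pass is determined by the memory at its start and by the values
    it reads, and it contains the final write of every cell, so it determines
    the output.  Since the output determines the input when [n >= 2], mapping
    an input to (memory, values read in the second pass padded to length [r])
    is injective, whence [2 ^ (n * d) <= 2 ^ t * 2 ^ (d * r)]. *)

Set Implicit Arguments.
Unset Strict Implicit.
Unset Printing Implicit Defensive.

Import GRing.Theory Num.Theory.

(** Each entry is the total minus its output, so all entries of [In] and [In'] differ by the same
    amount, the difference of the totals. Summing over [i], this difference equals [n] times itself,
    so it vanishes as [n > 1]. *)
Lemma sum_excl_self_inj n d (In In' : input n d) :
  1 < n -> sum_excl_self In =1 sum_excl_self In' -> In = In'.
Proof.
move=> n_gt1 eq_out; pose S (J : input n d) := (\sum_j (J j)%:Z)%R.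
have SE J i : S J = ((J i)%:Z + sum_excl_self J i)%R by rewrite /S (bigD1 i).
have diffE i : ((In i)%:Z - (In' i)%:Z = S In - S In')%R.
  by rewrite !(SE _ i) eq_out; lia.
have diffM : (S In - S In' = (S In - S In') *+ n)%R.
  have <- : (\sum_i ((In i)%:Z - (In' i)%:Z) = (S In - S In') *+ n)%R.
    by rewrite (eq_bigr _ (fun i _ => diffE i)) sumr_const card_ord.
  by rewrite sumrB.
have diff0 : (S In - S In' = 0)%R.
  apply/eqP; move: (_ - _)%R diffM => x; rewrite -(subnKC n_gt1) addSn mulrS.
  by move/eqP; rewrite -[X in X == _]addr0 (inj_eq (addrI x)) eq_sym mulrn_eq0.
by apply/ffunP=> i; apply/val_inj; have := diffE i; rewrite diff0 /=; lia.
Qed.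

Lemma foldl_exec_unwritten n (out : out_array n) tr j :
  ~~ has (writes_to j) tr -> foldl (@exec_event n) out tr j = out j.
Proof.
elim: tr out => //= e tr IH out; rewrite negb_or => /andP[ne_j /IH ->].
by case: e ne_j => //= i v ne_j; rewrite ffunE eq_sym (negbTE ne_j).
Qed.

Lemma foldl_exec_written n (out out' : out_array n) tr j :
  has (writes_to j) tr ->
  foldl (@exec_event n) out tr j = foldl (@exec_event n) out' tr j.
Proof.
elim: tr out out' => //= e tr IH out out'.
have [/IH eq_tr _|not_tr] := boolP (has (writes_to j) tr); first exact: eq_tr.
rewrite orbF !foldl_exec_unwritten //.
by case: e => //= i v /eqP ->; rewrite !ffunE eqxx.
Qed.

(** A dropped event that writes to [j] is not final, so a later write to [j] remains and fixes the
    cell whatever came before. *)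
Lemma output_second_pass n (tr : seq (event n)) j :
  has (writes_to j) tr -> output tr j = output (second_pass tr) j.
Proof.
elim: tr => // e tr IH has_j; rewrite [second_pass _]/=; case: ifP => // not_fin.
have has_tr : has (writes_to j) tr.
  move: has_j not_fin => /= /orP[|//].
  by case: e => //= i v /eqP -> /negbFE.
by rewrite -IH // /output /=; apply: foldl_exec_written.
Qed.

Section SecondPass.

Variables (n d : nat) (A : algorithm n d).

Definition read_values (In : input n d) (tr : seq (event n)) :
    seq 'I_(2 ^ d) :=
  pmap (fun e => if e is ReadEv i then Some (In i) else None) tr.

Lemma size_read_values In tr : size (read_values In tr) = count (@is_read n) tr.
Proof. by elim: tr => //= -[i|i v] tr /= ->. Qed.

(* Quantifying over all [k] compares the read sequences padded with [x0]. *)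
Lemma run_from_read_values x0 In In' m tr tr' :
  run_from A In m tr -> run_from A In' m tr' ->
  (forall k, nth x0 (read_values In tr) k = nth x0 (read_values In' tr') k) ->
  tr = tr'.
Proof.
move=> run_tr; elim: run_tr tr' => {m tr}
  [|m i next tr stepE _ IH|m i v next tr stepE _ IH] tr' run'.
- by inversion run'.
- inversion run' as
    [|m' i' next' tr'' stepE' run''|m' i' v' next' tr'' stepE'];
    subst; last by rewrite stepE in stepE'.
  move: stepE'; rewrite stepE => -[? ?]; subst=> eq_nth.
  (* Equal memories read the same cell, and index 0 says that both runs get the same value there, so
     the next memories agree too. *)
  have /= eq_i := eq_nth 0.
  rewrite -eq_i in run''.
  by rewrite (IH _ run'') // => k; apply: (eq_nth k.+1).
- inversion run' as
    [|m' i' next' tr'' stepE'|m' i' v' next' tr'' stepE' run''];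
    subst; first by rewrite stepE in stepE'.
  move: stepE'; rewrite stepE => -[? ? ?]; subst=> eq_nth.
  by rewrite (IH _ run'').
Qed.

Lemma run_from_inj In m tr tr' :
  run_from A In m tr -> run_from A In m tr' -> tr = tr'.
Proof.
move=> run_tr; elim: run_tr tr' => {m tr}
  [|m i next tr stepE _ IH|m i v next tr stepE _ IH] tr' run';
  inversion run' as
    [|m' i' next' tr'' stepE' run''|m' i' v' next' tr'' stepE' run''];
  subst=> //; move: stepE'; rewrite stepE // => -[]; intros; subst;
  by rewrite (IH _ run'').
Qed.

Lemma run_from_second_pass In m tr :
  run_from A In m tr -> exists m', run_from A In m' (second_pass tr).
Proof.
elim=> {m tr}
  [|m i next tr stepE _ [m' run']|m i v next tr stepE run_tr [m' run']].
- by exists None; constructor.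
- by exists m'.
- rewrite /=; case: ifP => _; last by exists m'.
  by exists (Some m); apply: run_write stepE run_tr.
Qed.

Hypotheses (n_gt1 : 1 < n) (solves : solves_sum_exclude_self A).

(** Memory and trace form a single pair so that one choice over all inputs yields both as functions
    of [In]. *)
Lemma second_pass_start In :
  exists mt : (mem_bits A).-tuple bool * seq (event n),
  [/\ run_from A In (Some mt.1) mt.2,
      forall i, output mt.2 i = Some (sum_excl_self In i) &
      exists2 tr, run A In tr & second_pass tr = mt.2].
Proof.
have [tr [run_tr out_tr]] := solves In.
have out_sp i : output (second_pass tr) i = Some (sum_excl_self In i).
  rewrite -out_tr -output_second_pass //.
  (* A cell never written in [tr] would still hold [None]. *)
  apply: contraT => /foldl_exec_unwritten - /(_ [ffun=> None]).
  by rewrite -/(output tr) out_tr ffunE.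
have [[m|] run_sp] := run_from_second_pass run_tr.
  by exists (m, second_pass tr); split=> //; exists tr.
(* A second pass starting after the end of execution is empty, which would leave cell 0
   unwritten. *)
have := out_sp (Ordinal (ltnW n_gt1)).
by inversion run_sp; rewrite /output /= ffunE.
Qed.

Lemma second_pass_reads_bound r :
  (forall In tr, run A In tr -> second_pass_reads tr <= r) ->
  n * d <= mem_bits A + d * r.
Proof.
move=> le_r; have [mt mtP] := fin_all_exists second_pass_start.
pose x0 : 'I_(2 ^ d) := Ordinal (expn_gt0 2 d).
pose values In := read_values In (mt In).2.
pose code In := ((mt In).1, [ffun k : 'I_r => nth x0 (values In) k]).
have size_values In : size (values In) <= r.
  have [_ _ [tr run_tr trE]] := mtP In.
  by rewrite /values size_read_values -trE; apply: le_r run_tr.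
have code_inj : injective code.
  move=> In In' [eq_m /ffunP eq_v].
  have [run_sp out_sp _] := mtP In; have [run_sp' out_sp' _] := mtP In'.
  rewrite -eq_m in run_sp'.
  have eq_tr : (mt In).2 = (mt In').2.
    apply: (run_from_read_values (x0 := x0) run_sp run_sp') => k.
    have [lt_kr|le_rk] := ltnP k r.
      by have := eq_v (Ordinal lt_kr); rewrite !ffunE.
    (* From index [r] on, both sequences are exhausted and both sides are the padding [x0]. *)
    by rewrite !nth_default // (leq_trans (size_values _)).
  apply: sum_excl_self_inj => // i.
  by apply: Some_inj; rewrite -out_sp -out_sp' eq_tr.
have := leq_card code code_inj.
rewrite card_prod card_tuple card_bool !card_ffun !card_ord -!expnM -expnD.
by rewrite leq_exp2l // mulnC.
Qed.

(** There are finitely many inputs, and by determinism the trace chosen for each is its only run. *)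
Lemma max_second_pass_reads_exists : exists r, max_second_pass_reads A r.
Proof.
have [tr trP] := fin_all_exists solves.
have inputs_gt0 : 0 < #|{: input n d}|.
  by rewrite card_ffun !card_ord !expn_gt0.
have [In0 maxE] := eq_bigmax (fun In => second_pass_reads (tr In)) inputs_gt0.
exists (\max_In second_pass_reads (tr In)); split.
  by exists In0, (tr In0); split; [case: (trP In0) | rewrite maxE].
move=> In tr' run_tr'; have [run_tr _] := trP In.
rewrite (run_from_inj run_tr' run_tr).
exact: (leq_bigmax (F := fun In => second_pass_reads (tr In))).
Qed.

End SecondPass.

Theorem theorem3 (n d t : nat) (hn : (2 <= n)%N) (hd : (1 <= d)%N)
  (A : algorithm n d) (hA : solves_sum_exclude_self A)
  (ht : (mem_bits A <= t)%N) :
  exists r : nat,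
    max_second_pass_reads A r /\
    (n * d - t <= d * r)%N /\
    (n - t %/ d <= r)%N.
Proof.
have [r max_r] := max_second_pass_reads_exists hA.
have le_nd : n * d <= t + d * r.
  apply: leq_trans (second_pass_reads_bound hn hA max_r.2) _.
  by rewrite leq_add2r.
exists r; split=> //; split; first by rewrite leq_subLR.
(* Dividing [n * d <= t + d * r] by [d] gives the floor form, since the multiple [r * d] leaves the
   floor as [r]. *)
rewrite leq_subLR -[n](mulnK _ hd) addnC -divnMDl // leq_div2r //.
by rewrite addnC [r * d]mulnC.
Qed.
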